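(* Let $M$ be a $\lambda\mu$-term with $rank(M)=k$. Then every $\beta\mu\rho\theta$-reduction sequence starting from $M$ has length less than $\mathrm{tower}(k+1,(2k+3)\cdot comp(M))$.
   Context: Terms are generated from $\lambda$-variables $x,y,\dots$ and $\mu$-variables $\alpha,\beta,\dots$ by $\mathcal T::=x\mid \lambda x.\mathcal T\mid\mu\alpha.\mathcal T\mid[\alpha]\mathcal T\mid(\mathcal T\,\mathcal T)$, modulo renaming of variables bound by $\lambda$ and $\mu$. $Fv(M)$ is the set of free variables of $M$. Complexity: $comp(x)=1$, $comp([\alpha]M)=comp(\lambda x.M)=comp(\mu\alpha.M)=comp(M)+1$, $comp(M\,N)=comp(M)+comp(N)$. Types are built from atomic types and the constant $\bot$ with $\to$; $\neg A$ is $A\to\bot$; $lh(A)$ is the number of arrows of $A$. A context $\Gamma$ is a finite set of declarations $x:A$ and $\alpha:\neg A$. Typing rules: $\Gamma,x:A\vdash x:A$; from $\Gamma,x:A\vdash M:B$ infer $\Gamma\vdash\lambda x.M:A\to B$; from $\Gamma\vdash M:A\to B$ and $\Gamma\vdash N:A$ infer $\Gamma\vdash M\,N:B$; from $\Gamma,\alpha:\neg A\vdash M:A$ infer $\Gamma,\alpha:\neg A\vdash[\alpha]M:\bot$; from $\Gamma,\alpha:\neg A\vdash M:\bot$ infer $\Gamma\vdash\mu\alpha.M:A$. All terms considered are typable ($\lambda\mu$-term means typable term), and types of subterms refer to a fixed typing derivation. Redexes and reduction rules: $(\lambda x.M)N\to_\beta M[x:=N]$; $(\mu\alpha.M)N\to_\mu\mu\alpha.M[\alpha:=_rN]$,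 where $M[\alpha:=_rN]$ is obtained by (recursively) replacing each subterm $[\alpha]U$ of $M$ ($\alpha$ free) by $[\alpha](U\,N)$; $[\alpha]\mu\beta.M\to_\rho M[\beta:=\alpha]$; $\mu\alpha.[\alpha]M\to_\theta M$ provided $\alpha\notin Fv(M)$. A $\beta\mu\rho\theta$-reduction step contracts one redex anywhere in a term. Rank of a redex $R$ in $M$: $lh(type(\lambda x.M_1))$ if $R=(\lambda x.M_1)M_2$; $lh(type(\mu\alpha.M_1))$ if $R=(\mu\alpha.M_1)M_2$; $lh(type(\mu\beta.M_1))$ if $R=[\alpha]\mu\beta.M_1$; $lh(type(\mu\alpha.[\alpha]M_1))$ if $R=\mu\alpha.[\alpha]M_1$ is a $\theta$-redex. $rank(M)$ is the maximum of the ranks of the redexes in $M$ (with $\max\emptyset=0$). $\mathrm{tower}(0,m)=m$ and $\mathrm{tower}(n,m)=2^{\mathrm{tower}(n-1,m)}$ for $n>0$. *)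

(* Defs.v *)
From mathcomp Require Import all_boot.

Set Implicit Arguments.
Unset Strict Implicit.
Unset Printing Implicit Defensive.

Inductive ty : Type :=
  | Atom of nat
  | Bot
  | Arrow of ty & ty.

Fixpoint lh (A : ty) : nat :=
  if A is Arrow B C then (lh B + lh C).+1 else 0.

(* Terms modulo renaming of bound variables, with de Bruijn indices. The lambda-
   and mu-variables are indexed independently: [Lam] binds lambda-index 0 and
   leaves mu-indices alone, [Mu] binds mu-index 0 and leaves lambda-indices
   alone. [Named a M] is [a]M. *)
Inductive term : Type :=
  | Var of nat
  | Lam of term
  | Mu of term
  | Named of nat & term
  | App of term & term.

Fixpoint complexity (M : term) : nat :=
  match M with
  | Var _ => 1
  | Lam M | Mu M | Named _ M => complexity M + 1
  | App M N => complexity M + complexity N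
  end.

(* Free occurrence of a mu-variable. *)
Fixpoint mfree (a : nat) (M : term) : bool :=
  match M with
  | Var _ => false
  | Lam M => mfree a M
  | Mu M => mfree a.+1 M
  | Named b M => (b == a) || mfree a M
  | App M N => mfree a M || mfree a N
  end.

Definition up_ren (f : nat -> nat) (n : nat) : nat :=
  if n is m.+1 then (f m).+1 else 0.

(* Renaming of the free lambda-variables. *)
Fixpoint lren (f : nat -> nat) (M : term) : term :=
  match M with
  | Var x => Var (f x)
  | Lam M => Lam (lren (up_ren f) M)
  | Mu M => Mu (lren f M)
  | Named a M => Named a (lren f M)
  | App M N => App (lren f M) (lren f N)
  end.

(* Renaming of the free mu-variables. *)
Fixpoint mren (f : nat -> nat) (M : term) : term :=
  match M with
  | Var x => Var x
  | Lam M => Lam (mren f M)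
  | Mu M => Mu (mren (up_ren f) M)
  | Named a M => Named (f a) (mren f M)
  | App M N => App (mren f M) (mren f N)
  end.

Definition up_subst (s : nat -> term) (x : nat) : term :=
  if x is y.+1 then lren succn (s y) else Var 0.

(* Simultaneous capture-avoiding substitution for the lambda-variables. *)
Fixpoint lsubst (s : nat -> term) (M : term) : term :=
  match M with
  | Var x => s x
  | Lam M => Lam (lsubst (up_subst s) M)
  | Mu M => Mu (lsubst (fun x => mren succn (s x)) M)
  | Named a M => Named a (lsubst s M)
  | App M N => App (lsubst s M) (lsubst s N)
  end.

(* M[x := N] with x the lambda-index 0 of M, which disappears. *)
Definition beta_subst (M N : term) : term :=
  lsubst (fun x => if x is y.+1 then Var y else N) M.

(* M[a :=_r N]; the mu-variable a remains. *)
Fixpoint struct_subst (a : nat) (N M : term) : term :=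
  match M with
  | Var x => Var x
  | Lam M => Lam (struct_subst a (lren succn N) M)
  | Mu M => Mu (struct_subst a.+1 (mren succn N) M)
  | Named b M =>
      if b == a then Named b (App (struct_subst a N M) N)
      else Named b (struct_subst a N M)
  | App M P => App (struct_subst a N M) (struct_subst a N P)
  end.

(* M[b := a] with b the mu-index 0 of M, which disappears. *)
Definition name_subst (M : term) (a : nat) : term :=
  mren (fun b => if b is c.+1 then c else a) M.

Inductive step : term -> term -> Prop :=
  | step_beta M N : step (App (Lam M) N) (beta_subst M N)
  | step_mu M N :
      step (App (Mu M) N) (Mu (struct_subst 0 (mren succn N) M))
  | step_rho a M : step (Named a (Mu M)) (name_subst M a)
  (* As mu-index 0 is not free in M, [mren predn] just removes the binder. *)
  | step_theta M : ~~ mfree 0 M -> step (Mu (Named 0 M)) (mren predn M)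
  | step_Lam M M' : step M M' -> step (Lam M) (Lam M')
  | step_Mu M M' : step M M' -> step (Mu M) (Mu M')
  | step_Named a M M' : step M M' -> step (Named a M) (Named a M')
  | step_Appl M M' N : step M M' -> step (App M N) (App M' N)
  | step_Appr M N N' : step N N' -> step (App M N) (App M N').

(* Curry-style typing. The entry A at position a of the second context stands
   for the declaration a : ~A. Derivations live in [Type], since the rank is
   computed from a derivation. *)
Inductive typing : seq ty -> seq ty -> term -> ty -> Type :=
  | ty_Var G D x A : onth G x = Some A -> typing G D (Var x) A
  | ty_Lam G D M A B :
      typing (A :: G) D M B -> typing G D (Lam M) (Arrow A B)
  | ty_App G D M N A B :
      typing G D M (Arrow A B) -> typing G D N A -> typing G D (App M N) B
  | ty_Named G D a M A :
      onth D a = Some A -> typing G D M A -> typing G D (Named a M) Bot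
  | ty_Mu G D M A : typing G (A :: D) M Bot -> typing G D (Mu M) A.

Definition is_Lam (M : term) : bool := if M is Lam _ then true else false.

Definition is_Mu (M : term) : bool := if M is Mu _ then true else false.

(* Whether [Mu M] is a theta-redex. *)
Definition is_theta_body (M : term) : bool :=
  if M is Named 0 P then ~~ mfree 0 P else false.

(* The ranks of all redex occurrences of the term typed by d. *)
Fixpoint redex_ranks G D M A (d : typing G D M A) : seq nat :=
  match d with
  | ty_Var _ _ _ _ _ => [::]
  | ty_Lam _ _ _ _ _ d1 => redex_ranks d1
  | ty_App _ _ M1 _ A B d1 d2 =>
      nseq (is_Lam M1 || is_Mu M1) (lh (Arrow A B))
        ++ redex_ranks d1 ++ redex_ranks d2
  | ty_Named _ _ _ M1 A _ d1 => nseq (is_Mu M1) (lh A) ++ redex_ranks d1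
  | ty_Mu _ _ M1 A d1 => nseq (is_theta_body M1) (lh A) ++ redex_ranks d1
  end.

Definition rank G D M A (d : typing G D M A) : nat :=
  \max_(r <- redex_ranks d) r.

Definition tower (n m : nat) : nat := iter n (expn 2) m.

(* Main.v *)
Require Import Defs.
From mathcomp Require Import all_boot.
From mathcomp Require Import zify.

(* If the head redex of M, with argument N, contracts to M', and if the
   reductions from M' and N have lengths at most a and b, then those from M have
   length at most a + b + 1: a step inside M is simulated by steps of M' or N.
   So the reductions from M can be measured on a tree built by the typing rules
   and by head expansion (as in Beckmann's work on the simply typed
   lambda-calculus). A cut is an application whose operator is not headed by a
   variable. Without cuts, height n gives length less than 2 ^ n. A cut whose
   operator has a type of maximal length is removed by substituting its argument,
   for a lambda- or a mu-variable, which takes heights n and m to 2 n + m + 1;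
   hence lowering the cut rank by one takes height n to at most 4 ^ n. A term of
   rank k has a tree of cut rank k and of height its complexity. The rho- and
   theta-redexes need no cuts: they duplicate nothing and use up a binder or a
   name. *)

Set Implicit Arguments.
Unset Strict Implicit.
Unset Printing Implicit Defensive.

(** * Renamings and simultaneous substitutions for both kinds of variables *)

Fixpoint ren (f g : nat -> nat) (M : term) : term :=
  match M with
  | Var x => Var (f x)
  | Lam M => Lam (ren (up_ren f) g M)
  | Mu M => Mu (ren f (up_ren g) M)
  | Named a M => Named (g a) (ren f g M)
  | App M N => App (ren f g M) (ren f g N)
  end.

Definition napp : term -> seq term -> term := foldl App.

Definition lup (s : nat -> term) (x : nat) : term :=
  if x is y.+1 then ren succn id (s y) else Var 0.

Definition tren (f g : nat -> nat) (t : nat -> nat * seq term) (a : nat) :=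
  (g (t a).1, map (ren f g) (t a).2).

Definition mup (t : nat -> nat * seq term) (a : nat) : nat * seq term :=
  if a is b.+1 then tren id succn t b else (0, [::]).

(* Substitution for both kinds of variables: [t a = (b, L)] replaces every
   [Named a U] by [Named b (U L_1 ... L_n)]. With argument lists of any length
   these substitutions are closed under composition, and renamings,
   [beta_subst], [struct_subst] and [name_subst] are instances. *)
Fixpoint sub (s : nat -> term) (t : nat -> nat * seq term) (M : term) : term :=
  match M with
  | Var x => s x
  | Lam M => Lam (sub (lup s) (tren succn id t) M)
  | Mu M => Mu (sub (fun x => ren id succn (s x)) (mup t) M)
  | Named a M => Named (t a).1 (napp (sub s t M) (t a).2)
  | App M N => App (sub s t M) (sub s t N)
  end.

Definition noarg (g : nat -> nat) (a : nat) : nat * seq term := (g a, [::]).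

Definition scons (N : term) (x : nat) : term := if x is y.+1 then Var y else N.

Definition addargs (L : seq term) (a : nat) : nat * seq term :=
  (a, if a is 0 then L else [::]).

Lemma eq_up_ren f f' : f =1 f' -> up_ren f =1 up_ren f'.
Proof. by move=> e [|x] //=; rewrite e. Qed.

Lemma eq_ren f f' g g' M : f =1 f' -> g =1 g' -> ren f g M = ren f' g' M.
Proof.
elim: M f f' g g' => [x|M IH|M IH|a M IH|M IHM N IHN] f f' g g' ef eg /=.
- by rewrite ef.
- by congr Lam; apply: IH => //; apply: eq_up_ren.
- by congr Mu; apply: IH => //; apply: eq_up_ren.
- by rewrite eg (IH _ _ _ _ ef eg).
- by rewrite (IHM _ _ _ _ ef eg) (IHN _ _ _ _ ef eg).
Qed.

Lemma eq_sub s s' t t' M : s =1 s' -> t =1 t' -> sub s t M = sub s' t' M.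
Proof.
elim: M s s' t t' => [x|M IH|M IH|a M IH|M IHM N IHN] s s' t t' es et /=.
- exact: es.
- congr Lam; apply: IH => [[|x]|a] //=; rewrite ?es // /tren et //.
- congr Mu; apply: IH => [x|[|a]] //=; rewrite ?es // /tren et //.
- by rewrite et (IH _ _ _ _ es et).
- by rewrite (IHM _ _ _ _ es et) (IHN _ _ _ _ es et).
Qed.

Lemma ren_napp f g M L : ren f g (napp M L) = napp (ren f g M) (map (ren f g) L).
Proof. by elim: L M => //= N L IH M; rewrite IH. Qed.

Lemma sub_napp s t M L : sub s t (napp M L) = napp (sub s t M) (map (sub s t) L).
Proof. by elim: L M => //= N L IH M; rewrite IH. Qed.

Lemma napp_cat M L L' : napp (napp M L) L' = napp M (L ++ L').
Proof. by rewrite /napp foldl_cat. Qed.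

Lemma renE f g M : ren f g M = sub (Var \o f) (noarg g) M.
Proof.
elim: M f g => [x|M IH|M IH|a M IH|M IHM N IHN] f g //=.
- by rewrite IH; congr Lam; apply: eq_sub => [[|x]|a].
- by rewrite IH; congr Mu; apply: eq_sub => [x|[|a]].
- by rewrite IH.
- by rewrite IHM IHN.
Qed.

Lemma ren_ren f f' g g' M :
  ren f g (ren f' g' M) = ren (f \o f') (g \o g') M.
Proof.
elim: M f f' g g' => [x|M IH|M IH|a M IH|M IHM N IHN] f f' g g' //=.
- by rewrite IH; congr Lam; apply: eq_ren => [[|x]|a].
- by rewrite IH; congr Mu; apply: eq_ren => [x|[|a]].
- by rewrite IH.
- by rewrite IHM IHN.
Qed.

Lemma sub_ren s t f g M : sub s t (ren f g M) = sub (s \o f) (t \o g) M.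
Proof.
elim: M s t f g => [x|M IH|M IH|a M IH|M IHM N IHN] s t f g //=.
- by rewrite IH; congr Lam; apply: eq_sub => [[|x]|a].
- by rewrite IH; congr Mu; apply: eq_sub => [x|[|a]].
- by rewrite IH.
- by rewrite IHM IHN.
Qed.

Lemma ren_sub s t f g M :
  ren f g (sub s t M) = sub (ren f g \o s) (tren f g t) M.
Proof.
elim: M s t f g => [x|M IH|M IH|a M IH|M IHM N IHN] s t f g //=.
- rewrite IH; congr Lam; apply: eq_sub => [[|x]|a] //=.
    by rewrite !ren_ren; apply: eq_ren.
  rewrite /tren /= -!map_comp; congr pair; apply: eq_map => N /=.
  by rewrite !ren_ren; apply: eq_ren.
- rewrite IH; congr Mu; apply: eq_sub => [x|[|a]] //=.
    by rewrite !ren_ren; apply: eq_ren.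
  rewrite /tren /= -!map_comp; congr pair; apply: eq_map => N /=.
  by rewrite !ren_ren; apply: eq_ren.
- by rewrite ren_napp IH.
- by rewrite IHM IHN.
Qed.

(** The arguments that [t'] adds stand nearer to the named term, so they come first and are
    substituted into; those that [t] adds at the new name follow. *)
Definition tcomp s t (t' : nat -> nat * seq term) (a : nat) :=
  ((t (t' a).1).1, map (sub s t) (t' a).2 ++ (t (t' a).1).2).

Lemma sub_sub s t s' t' M :
  sub s t (sub s' t' M) = sub (sub s t \o s') (tcomp s t t') M.
Proof.
elim: M s t s' t' => [x|M IH|M IH|a M IH|M IHM N IHN] s t s' t' //=.
- rewrite IH; congr Lam; apply: eq_sub => [[|x]|a] //=.
    by rewrite sub_ren ren_sub; apply: eq_sub.
  rewrite /tcomp /tren /= map_cat -!map_comp; congr (_, _ ++ _).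
  by apply: eq_map => N /=; rewrite sub_ren ren_sub; apply: eq_sub.
- rewrite IH; congr Mu; apply: eq_sub => [x|[|a]] //=.
    by rewrite sub_ren ren_sub; apply: eq_sub.
  rewrite /tcomp /tren /= map_cat -!map_comp; congr (_, _ ++ _).
  by apply: eq_map => N /=; rewrite sub_ren ren_sub; apply: eq_sub.
- by rewrite sub_napp IH napp_cat.
- by rewrite IHM IHN.
Qed.

Lemma sub_id s t M : s =1 Var -> t =1 noarg id -> sub s t M = M.
Proof.
elim: M s t => [x|M IH|M IH|a M IH|M IHM N IHN] s t es et /=.
- exact: es.
- congr Lam; apply: IH => [[|x]|a] //=; rewrite ?es // /tren et //.
- congr Mu; apply: IH => [x|[|a]] //=; rewrite ?es // /tren et //.
- by rewrite et IH.
- by rewrite IHM ?IHN.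
Qed.

Lemma ren_id f g M : f =1 id -> g =1 id -> ren f g M = M.
Proof.
move=> ef eg; rewrite renE; apply: sub_id => x /=.
  by rewrite ef.
by rewrite /noarg eg.
Qed.

(** * The substitutions of the reduction rules as instances *)

Lemma lrenE f M : lren f M = ren f id M.
Proof.
elim: M f => [x|M IH|M IH|a M IH|M IHM N IHN] f //=.
- by rewrite IH.
- by rewrite IH; congr Mu; apply: eq_ren => // -[].
- by rewrite IH.
- by rewrite IHM IHN.
Qed.

Lemma mrenE g M : mren g M = ren id g M.
Proof.
elim: M g => [x|M IH|M IH|a M IH|M IHM N IHN] g //=.
- by rewrite IH; congr Lam; apply: eq_ren => // -[].
- by rewrite IH.
- by rewrite IH.
- by rewrite IHM IHN.
Qed.

Lemma lsubstE s M : lsubst s M = sub s (noarg id) M.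
Proof.
elim: M s => [x|M IH|M IH|a M IH|M IHM N IHN] s //=.
- rewrite IH; congr Lam; apply: eq_sub => // -[|x] //=; exact: lrenE.
- rewrite IH; congr Mu; apply: eq_sub => [x|[|a]] //=; exact: mrenE.
- by rewrite IH.
- by rewrite IHM IHN.
Qed.

Lemma struct_substE a N M :
  struct_subst a N M =
  sub Var (fun b => (b, if b == a then [:: N] else [::])) M.
Proof.
elim: M a N => [x|M IH|M IH|b M IH|M IHM P IHP] a N //=.
- rewrite IH; congr Lam; apply: eq_sub => [[|x]|b] //=.
  by rewrite /tren /= lrenE; case: (b == a).
- rewrite IH; congr Mu; apply: eq_sub => [x|[|b]] //=.
  by rewrite /tren /= mrenE eqSS; case: (b == a).
- by rewrite IH; case: (b == a).
- by rewrite IHM IHP.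
Qed.

Lemma beta_substE M N : beta_subst M N = sub (scons N) (noarg id) M.
Proof. exact: lsubstE. Qed.

Lemma struct_subst0E N M :
  struct_subst 0 (mren succn N) M = sub Var (addargs [:: ren id succn N]) M.
Proof. by rewrite struct_substE mrenE; apply: eq_sub => // -[|b]. Qed.

Definition name_ren (a b : nat) : nat := if b is c.+1 then c else a.

Lemma name_substE M a : name_subst M a = ren id (name_ren a) M.
Proof. exact: mrenE. Qed.

(** Substituting and then contracting is a single substitution, so that an induction hypothesis on
    the body applies directly to the contractum. *)
Lemma beta_subst_sub s t M N :
  beta_subst (sub (lup s) (tren succn id t) M) N =
  sub (fun x => if x is y.+1 then s y else N) t M.
Proof.
rewrite beta_substE sub_sub; apply: eq_sub => [[|x]|a] //=.
  by rewrite sub_ren sub_id.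
rewrite /tcomp /noarg /tren /= cats0 -map_comp.
rewrite (eq_map (g := id)) ?map_id; first by case: (t a).
by move=> P /=; rewrite sub_ren sub_id.
Qed.

Lemma sub_beta s t M N :
  sub s t (beta_subst M N) =
  beta_subst (sub (lup s) (tren succn id t) M) (sub s t N).
Proof.
rewrite beta_subst_sub beta_substE sub_sub; apply: eq_sub => [[|x]|a] //.
by rewrite /tcomp /=; case: (t a).
Qed.

Definition mcons N (t : nat -> nat * seq term) (a : nat) :=
  if a is b.+1 then tren id succn t b else (0, [:: ren id succn N]).

(** The mu-counterpart of [beta_subst_sub]: the bound name, left alone by [mup t], now takes the
    argument [N]. *)
Lemma struct_subst_sub s t M N :
  struct_subst 0 (mren succn N)
    (sub (fun x => ren id succn (s x)) (mup t) M) =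
  sub (fun x => ren id succn (s x)) (mcons N t) M.
Proof.
rewrite struct_subst0E sub_sub; apply: eq_sub => [x|[|a]] //=.
  by rewrite sub_ren -[RHS](sub_id (s := Var) (t := noarg id)) // sub_ren.
rewrite /tcomp /tren /= cats0 -map_comp; congr pair; apply: eq_map => P /=.
by rewrite sub_ren -[RHS](sub_id (s := Var) (t := noarg id)) // sub_ren.
Qed.

Lemma sub_struct s t M N :
  sub (fun x => ren id succn (s x)) (mup t) (struct_subst 0 (mren succn N) M) =
  struct_subst 0 (mren succn (sub s t N))
    (sub (fun x => ren id succn (s x)) (mup t) M).
Proof.
rewrite struct_subst_sub struct_subst0E sub_sub.
by apply: eq_sub => [x|[|a]] //=; rewrite /tcomp /= sub_ren ren_sub.
Qed.

(** * Free mu-variables and theta-redexes *)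

Lemma mfree_mren f a a' M :
  (forall b, (f b == a') = (b == a)) -> mfree a' (mren f M) = mfree a M.
Proof.
elim: M f a a' => [x|M IH|M IH|b M IH|M IHM N IHN] f a a' e //=.
- exact: IH.
- by apply: IH => -[|b] //=; rewrite !eqSS e.
- by rewrite e (IH _ _ _ e).
- by rewrite (IHM _ _ _ e) (IHN _ _ _ e).
Qed.

Lemma mfree_mren_out f a M : (forall b, f b != a) -> ~~ mfree a (mren f M).
Proof.
elim: M f a => [x|M IH|M IH|b M IH|M IHM N IHN] f a e //=.
- exact: IH.
- by apply: IH => -[|b] //=; rewrite !eqSS.
- by rewrite negb_or e IH.
- by rewrite negb_or IHM ?IHN.
Qed.

Lemma eq_mren_free f g a M :
  (forall b, b != a -> f b = g b) -> ~~ mfree a M -> mren f M = mren g M.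
Proof.
elim: M f g a => [x|M IH|M IH|b M IH|M IHM N IHN] f g a e //=.
- by move=> nf; rewrite (IH _ _ _ e nf).
- move=> nf; congr Mu; apply: (IH _ _ _ _ nf) => -[|b] //=.
  by rewrite eqSS => /e ->.
- by case/norP=> /e -> nf; rewrite (IH _ _ _ e nf).
- by case/norP=> nM nN; rewrite (IHM _ _ _ e nM) (IHN _ _ _ e nN).
Qed.

Lemma mren_pred_succ M : mren predn (mren succn M) = M.
Proof. by rewrite !mrenE ren_ren ren_id. Qed.

(** Theta-redexes can thus be written [Mu (Named 0 (mren succn M))], a form that has the side
    condition built in and is visibly preserved by substitution. *)
Lemma not_mfree_shift M : ~~ mfree 0 M -> M = mren succn (mren predn M).
Proof.
move=> nf; rewrite !mrenE ren_ren -[LHS](@ren_id id id) // -!mrenE.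
by apply: (eq_mren_free _ nf) => -[|b].
Qed.

Lemma step_theta_shift M : step (Mu (Named 0 (mren succn M))) M.
Proof.
rewrite -[X in step _ X]mren_pred_succ.
by apply: step_theta; apply: mfree_mren_out.
Qed.

(** * Reduction sequences and their stability under substitution *)

Inductive steps : term -> term -> Prop :=
  | steps_refl M : steps M M
  | steps_cons M P Q : step M P -> steps P Q -> steps M Q.

Definition psteps M Q := exists2 P, step M P & steps P Q.

Lemma steps_trans M P Q : steps M P -> steps P Q -> steps M Q.
Proof. by elim=> // {}M P' Q' st _ IH /IH; apply: steps_cons. Qed.

Lemma steps1 M P : step M P -> steps M P.
Proof. by move=> st; apply: steps_cons st (steps_refl P). Qed.

Lemma psteps1 M P : step M P -> psteps M P.
Proof. by move=> st; exists P => //; apply: steps_refl. Qed.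

Lemma psteps_steps M P : psteps M P -> steps M P.
Proof. by case=> Q; apply: steps_cons. Qed.

Lemma steps_psteps M P Q : steps M P -> psteps P Q -> psteps M Q.
Proof.
case=> // {}M P' {}P st sts pq; exists P' => //.
exact: steps_trans sts (psteps_steps pq).
Qed.

Lemma steps_congr (C : term -> term) M P :
  (forall M P, step M P -> step (C M) (C P)) -> steps M P -> steps (C M) (C P).
Proof.
by move=> H; elim=> [{}M|{}M P' Q st _ IH];
  [exact: steps_refl | apply: steps_cons IH; apply: H].
Qed.

Lemma psteps_congr (C : term -> term) M P :
  (forall M P, step M P -> step (C M) (C P)) ->
  psteps M P -> psteps (C M) (C P).
Proof.
by move=> H [Q st sts]; exists (C Q); [apply: H | apply: steps_congr].
Qed.

Lemma steps_App M M' N N' : steps M M' -> steps N N' -> steps (App M N) (App M' N').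
Proof.
move=> sM sN; apply: (@steps_trans _ (App M' N)).
  by apply: (steps_congr (C := App^~ N)) sM => *; apply: step_Appl.
by apply: steps_congr sN => *; apply: step_Appr.
Qed.

Lemma step_napp M M' L : step M M' -> step (napp M L) (napp M' L).
Proof. by elim: L M M' => //= N L IH M M' st; apply/IH/step_Appl. Qed.

(** Substitution into a rho-redex may put arguments between the name and the [Mu]; the mu absorbs
    them one after the other. *)
Lemma steps_Mu_napp M L :
  steps (napp (Mu M) L) (Mu (sub Var (addargs (map (ren id succn) L)) M)).
Proof.
elim: L M => [|N L IH] M /=.
  by rewrite sub_id //=; [exact: steps_refl | case].
apply: steps_cons; first by apply: step_napp; apply: step_mu.
rewrite struct_subst0E.
set M' := sub _ _ M; have := IH M'; rewrite sub_sub.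
rewrite (@eq_sub _ Var _ (addargs [seq ren id succn i | i <- N :: L])) //.
case=> [|b] //=; rewrite /tcomp /= sub_ren.
by rewrite (@eq_sub _ (Var \o id) _ (noarg succn)) // -renE.
Qed.

(** At least one step is kept, which later makes length bounds decrease; a rho-step may turn into
    several steps. *)
Lemma psteps_sub s t M M' : step M M' -> psteps (sub s t M) (sub s t M').
Proof.
move=> st; elim: st s t => {M M'}.
- by move=> M N s t; rewrite sub_beta; apply/psteps1/step_beta.
- by move=> M N s t /=; rewrite sub_struct; apply/psteps1/step_mu.
- move=> a M s t /=.
  set M' := sub _ _ M.
  (* [M1] is the body once the mu has absorbed the arguments that [t] attaches to [a]; only then is
     there a rho-redex again. *)
  set M1 := sub Var (addargs (map (ren id succn) (t a).2)) M'.
  apply: (steps_psteps (P := Named (t a).1 (Mu M1))).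
    by apply: steps_congr (steps_Mu_napp _ _) => *; apply: step_Named.
  have -> : sub s t (name_subst M a) = name_subst M1 (t a).1.
    rewrite /M1 /M'.
    rewrite !name_substE sub_ren sub_sub ren_sub; apply: eq_sub => [x|[|b]] /=.
    - rewrite sub_ren ren_sub.
      by rewrite [LHS](_ : _ = sub Var (noarg id) (s x)) ?sub_id //; apply: eq_sub.
    - rewrite /tren /tcomp /= -map_comp.
      rewrite (eq_map (g := id)) ?map_id; first by case: (t a).
      by move=> P /=; rewrite ren_ren ren_id.
    - rewrite /tren /tcomp /= cats0 -!map_comp.
      rewrite (eq_map (g := id)) ?map_id; first by case: (t b).
      move=> P /=; rewrite sub_ren ren_sub sub_id //.
  by apply: psteps1; apply: step_rho.
- move=> M /not_mfree_shift e s t; rewrite {1}e; set P := mren predn M.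
  rewrite /= (_ : sub _ _ _ = mren succn (sub s t P)); last first.
    by rewrite !mrenE sub_ren ren_sub; apply: eq_sub.
  exact/psteps1/step_theta_shift.
- by move=> M M' _ IH s t /=; apply: psteps_congr (IH _ _) => *; apply: step_Lam.
- by move=> M M' _ IH s t /=; apply: psteps_congr (IH _ _) => *; apply: step_Mu.
- move=> a M M' _ IH s t /=.
  by apply: (psteps_congr (C := fun U => Named _ (napp U _))) (IH _ _) => *;
    apply/step_Named/step_napp.
- move=> M M' N _ IH s t /=.
  by apply: (psteps_congr (C := App^~ _)) (IH _ _) => *; apply: step_Appl.
- by move=> M N N' _ IH s t /=; apply: psteps_congr (IH _ _) => *; apply: step_Appr.
Qed.

Lemma psteps_ren f g M M' : step M M' -> psteps (ren f g M) (ren f g M').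
Proof. by rewrite !renE; apply: psteps_sub. Qed.

Lemma steps_ren f g M M' : steps M M' -> steps (ren f g M) (ren f g M').
Proof.
elim=> [{}M|{}M P Q st _ IH]; first exact: steps_refl.
exact: steps_trans (psteps_steps (psteps_ren _ _ st)) IH.
Qed.

(** The variable may occur any number of times, possibly never, hence [steps] and not [psteps]. *)
Lemma steps_lsubst s s' M :
  (forall x, steps (s x) (s' x)) -> steps (lsubst s M) (lsubst s' M).
Proof.
elim: M s s' => [x|M IH|M IH|b M IH|M IHM N IHN] s s' ss //=.
- apply: steps_congr; first exact: step_Lam.
  apply: IH => -[|x] /=; first exact: steps_refl.
  by rewrite !lrenE; apply: steps_ren.
- apply: steps_congr; first exact: step_Mu.
  by apply: IH => x; rewrite !mrenE; apply: steps_ren.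
- by apply: steps_congr (IH _ _ ss) => *; apply: step_Named.
- by apply: steps_App; [apply: IHM | apply: IHN].
Qed.

Lemma steps_struct_subst a N N' M :
  steps N N' -> steps (struct_subst a N M) (struct_subst a N' M).
Proof.
elim: M a N N' => [x|M IH|M IH|b M IH|M IHM P IHP] a N N' sN //=.
- exact: steps_refl.
- apply: steps_congr; first exact: step_Lam.
  by apply: IH; rewrite !lrenE; apply: steps_ren.
- apply: steps_congr; first exact: step_Mu.
  by apply: IH; rewrite !mrenE; apply: steps_ren.
- case: eqP => _; apply: steps_congr; try exact: step_Named.
    by apply: steps_App => //; apply: IH.
  exact: IH.
- by apply: steps_App; [apply: IHM | apply: IHP].
Qed.

(** * Head reduction and its interaction with arbitrary steps *)

(* In [head_step M N M'], N is the argument of the contracted redex. *)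
Inductive head_step : term -> term -> term -> Prop :=
  | head_beta M N : head_step (App (Lam M) N) N (beta_subst M N)
  | head_mu M N :
      head_step (App (Mu M) N) N (Mu (struct_subst 0 (mren succn N) M))
  | head_App M P M' N : head_step M P M' -> head_step (App M N) P (App M' N).

Lemma head_step_sub s t M N M' :
  head_step M N M' -> head_step (sub s t M) (sub s t N) (sub s t M').
Proof.
elim=> {M N M'} [M N|M N|M P M' N _ IH] /=.
- by rewrite sub_beta; apply: head_beta.
- by rewrite sub_struct; apply: head_mu.
- exact: head_App.
Qed.

Lemma struct_subst_id a N M : ~~ mfree a M -> struct_subst a N M = M.
Proof.
elim: M a N => [x|M IH|M IH|b M IH|M IHM P IHP] a N //=.
- by move=> /IH ->.
- by move=> /IH ->.
- by case/norP=> /negbTE -> /IH ->.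
- by case/norP=> /IHM -> /IHP ->.
Qed.

Lemma step_Lam_inv M P : step (Lam M) P -> exists2 M', step M M' & P = Lam M'.
Proof. by move=> st; inversion st; subst; exists M'. Qed.

Lemma step_Mu_inv M P : step (Mu M) P ->
  (exists2 M', step M M' & P = Mu M') \/
  (exists2 Q, ~~ mfree 0 Q & M = Named 0 Q /\ P = mren predn Q).
Proof.
move=> st; inversion st; subst; first by right; exists M0.
by left; exists M'.
Qed.

Lemma step_Named_inv a M P : step (Named a M) P ->
  (exists2 M', step M M' & P = Named a M') \/
  (exists2 Q, M = Mu Q & P = name_subst Q a).
Proof.
move=> st; inversion st; subst; first by right; exists M0.
by left; exists M'.
Qed.

Lemma step_App_inv M N P : step (App M N) P ->
  [\/ exists2 Q, M = Lam Q & P = beta_subst Q N,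
      exists2 Q, M = Mu Q & P = Mu (struct_subst 0 (mren succn N) Q),
      exists2 M', step M M' & P = App M' N |
      exists2 N', step N N' & P = App M N'].
Proof.
move=> st; inversion st; subst.
- by apply: Or41; exists M0.
- by apply: Or42; exists M0.
- by apply: Or43; exists M'.
- by apply: Or44; exists N'.
Qed.

(* The last case arises from a theta-step at the head mu. *)
Lemma head_step_step M N M' P : head_step M N M' -> step M P ->
  [\/ P = M',
      exists2 P', head_step P N P' & psteps M' P',
      exists N' P', [/\ head_step P N' P', step N N' & steps M' P'] |
      psteps M' P].
Proof.
move=> hd; elim: hd P => {M N M'} [M N|M N|M Q M' N hd IH] P st.
- case: (step_App_inv st) => [[Q [<-] ->]|[Q //]|[M1 stM ->]|[N' stN ->]].
  + exact: Or41.
  + case: (step_Lam_inv stM) => M' stM' ->; apply: Or42; exists (beta_subst M' N).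
      exact: head_beta.
    by rewrite !beta_substE; apply: psteps_sub.
  + apply: Or43; exists N', (beta_subst M N'); split => //; first exact: head_beta.
    apply: steps_lsubst => -[|x]; [exact: steps1 | exact: steps_refl].
- case: (step_App_inv st) => [[Q //]|[Q [<-] ->]|[M1 stM ->]|[N' stN ->]].
  + exact: Or41.
  + case: (step_Mu_inv stM) => [[M' stM' ->]|[Q nf [-> ->]]].
      apply: Or42; eexists; first exact: head_mu.
      apply: psteps_congr; first exact: step_Mu.
      by rewrite !struct_subst0E; apply: psteps_sub.
    (* As 0 is not free in [Q], the contractum is [Mu (Named 0 (App Q (mren succn N)))], a
       theta-redex that contracts to the term in question. *)
    apply: Or44 => /=; rewrite struct_subst_id //.
    rewrite {1}(not_mfree_shift nf).
    exact/psteps1/(step_theta_shift (App (mren predn Q) N)).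
  + apply: Or43; exists N'; eexists; split => //; first exact: head_mu.
    apply: steps_congr; first exact: step_Mu.
    by apply: steps_struct_subst; rewrite !mrenE; apply/psteps_steps/psteps_ren.
- case: (step_App_inv st) => [[R e]|[R e]|[M1 stM ->]|[N' stN ->]].
  + by rewrite e in hd; inversion hd.
  + by rewrite e in hd; inversion hd.
  + case: (IH _ stM) => [->|[P' hd' sts]|[N' [P' [hd' stN sts]]]|sts].
    * exact: Or41.
    * apply: Or42; exists (App P' N); first exact: head_App.
      by apply: (psteps_congr (C := App^~ N)) sts => *; apply: step_Appl.
    * apply: Or43; exists N', (App P' N); split => //; first exact: head_App.
      by apply: (steps_congr (C := App^~ N)) sts => *; apply: step_Appl.
    * apply: Or44.
      by apply: (psteps_congr (C := App^~ N)) sts => *; apply: step_Appl.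
  + apply: Or42; exists (App M' N'); first exact: head_App.
    by apply: psteps1; apply: step_Appr.
Qed.

(** * Bounds on the lengths of reductions *)

Fixpoint bounded n M :=
  forall M', step M M' -> if n is m.+1 then bounded m M' else False.

Lemma bounded_le n m M : bounded n M -> n <= m -> bounded m M.
Proof.
elim: n m M => [|n IH] [|m] M //= b lnm M' st.
- by case: (b _ st).
- exact: IH (b _ st) lnm.
Qed.

Lemma bounded_steps n M M' : steps M M' -> bounded n M -> bounded n M'.
Proof.
move=> sts; elim: sts n => // {}M P Q st _ IH [|n] b; first by case: (b _ st).
by apply: IH; apply: bounded_le (b _ st) _.
Qed.

Lemma bounded_psteps n M M' :
  psteps M M' -> bounded n M -> exists2 m, n = m.+1 & bounded m M'.
Proof.
case=> P st sts; case: n => [|n] b; first by case: (b _ st).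
by exists n => //; apply: bounded_steps sts (b _ st).
Qed.

Lemma bounded_inner n M (C : term -> term) :
  (forall M P, step M P -> step (C M) (C P)) -> bounded n (C M) -> bounded n M.
Proof.
move=> H; elim: n M => [|n IH] M b P st; first exact: b _ (H _ _ st).
by apply: IH; apply: b; apply: H.
Qed.

(** Induction on [a + b]. A step that keeps the head redex either forces a step of [M'], lowering
    [a], or is a step of [N], lowering [b] while [M'] makes any number of steps. Every other step
    leads to [M'] or one of its reducts. *)
Lemma bounded_head_step M N M' a b :
  head_step M N M' -> bounded a M' -> bounded b N -> bounded (a + b).+1 M.
Proof.
have [n le] := ubnP (a + b); elim: n => // n IH in a b M N M' le *.
move=> hd bM bN P st; change (bounded (a + b) P).
case: (head_step_step hd st) => [->|[P' hd' sts]|[N' [P' [hd' stN sts]]]|sts].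
- by apply: bounded_le bM _; lia.
- have [m e bm] := bounded_psteps sts bM; subst a.
  by apply: bounded_le (IH _ _ _ _ _ _ hd' bm bN) _; lia.
- have [m e bm] := bounded_psteps (psteps1 stN) bN; subst b.
  by apply: bounded_le (IH _ _ _ _ _ _ hd' (bounded_steps sts bM) bm) _; lia.
- have [m e bm] := bounded_psteps sts bM; subst a.
  by apply: bounded_le bm _; lia.
Qed.

Lemma mren_mren f g M : mren f (mren g M) = mren (f \o g) M.
Proof. by rewrite !mrenE ren_ren. Qed.

Lemma ren_beta f g M N :
  ren f g (beta_subst M N) = beta_subst (ren (up_ren f) g M) (ren f g N).
Proof.
rewrite !renE sub_beta; congr beta_subst; apply: eq_sub => // -[|x] //.
Qed.

Lemma mren_struct g M N :
  mren (up_ren g) (struct_subst 0 (mren succn N) M) =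
  struct_subst 0 (mren succn (mren g N)) (mren (up_ren g) M).
Proof.
have e P : mren (up_ren g) P = sub (fun x => ren id succn (Var x)) (mup (noarg g)) P.
  by rewrite mrenE renE; apply: eq_sub => // -[].
by rewrite !e sub_struct (mrenE g) renE.
Qed.

(** Renaming mu-variables, even identifying some, creates no redex: no rule compares two free names,
    and [up_ren g] sends only 0 to 0, so the theta condition is reflected. Bounds thus pass to rho-
    and theta-contracta, which are renamings of subterms. *)
Lemma step_mren_inv g M P :
  step (mren g M) P -> exists2 M', step M M' & P = mren g M'.
Proof.
elim: M g P => [x|M IH|M IH|b M IH|M IHM N IHN] g P st.
- by inversion st.
- case: (step_Lam_inv st) => P' /IH [M' stM ->] ->; exists (Lam M') => //.
  exact: step_Lam.
- case: (step_Mu_inv st) => [[P' /IH [M' stM ->] ->]|[Q nf [e ->]]].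
    by exists (Mu M') => //; apply: step_Mu.
  case: M {IH st} e => //= -[|b] //= M [e]; subst Q.
  exists (mren predn M).
    apply: step_theta; rewrite (@mfree_mren _ 0) // in nf.
    by case.
  rewrite !mren_mren; apply: (@eq_mren_free _ _ 0) => [[|b]|] //.
  by rewrite (@mfree_mren _ 0) // in nf; case.
- case: (step_Named_inv st) => [[P' /IH [M' stM ->] ->]|[Q e ->]].
    by exists (Named b M') => //; apply: step_Named.
  case: M {IH st} e => //= M [<-]; fold mren.
  exists (name_subst M b); first exact: step_rho.
  by rewrite !name_substE !mrenE !ren_ren; apply: eq_ren => // -[].
- case: (step_App_inv st) =>
    [[Q e ->]|[Q e ->]|[P' /IHM [M' stM ->] ->]|[P' /IHN [N' stN ->] ->]].
  + case: M {IHM st} e => //= M [<-]; fold mren.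
    exists (beta_subst M N); first exact: step_beta.
    by rewrite !mrenE ren_beta; congr beta_subst; apply: eq_ren => // -[].
  + case: M {IHM st} e => //= M [<-]; fold mren.
    exists (Mu (struct_subst 0 (mren succn N) M)); first exact: step_mu.
    by rewrite /= mren_struct.
  + by exists (App M' N) => //; apply: step_Appl.
  + by exists (App M N') => //; apply: step_Appr.
Qed.

Lemma bounded_mren n g M : bounded n M -> bounded n (mren g M).
Proof.
elim: n M => [|n IH] M b P /step_mren_inv [M' st e]; first exact: b _ st.
by rewrite e; apply: IH; apply: b.
Qed.

Lemma bounded_Lam n M : bounded n M -> bounded n (Lam M).
Proof.
elim: n M => [|n IH] M b P /step_Lam_inv [M' st e]; first exact: b _ st.
by rewrite e; apply: IH; apply: b.
Qed.

Lemma boundedS n M :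
  (forall M', step M M' -> bounded n M') -> bounded n.+1 M.
Proof. by []. Qed.

(** The extra step is a theta-step at the root: it leaves a renaming of a subterm of [M], whose
    bound is inherited. For [bounded_Named] a rho-step does the same. *)
Lemma bounded_Mu n M : bounded n M -> bounded n.+1 (Mu M).
Proof.
elim: n M => [|n IH] M b; apply: boundedS => P.
all: case/step_Mu_inv=> [[M' st ->]|[Q _ [e ->]]].
- by case: (b _ st).
- apply: bounded_mren; apply: (@bounded_inner _ _ (Named 0)); last by rewrite -e.
  by move=> *; apply: step_Named.
- by apply: IH; apply: b.
- apply: bounded_mren; apply: (@bounded_inner _ _ (Named 0)); last by rewrite -e.
  by move=> *; apply: step_Named.
Qed.

Lemma bounded_Named n a M : bounded n M -> bounded n.+1 (Named a M).
Proof.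
elim: n M => [|n IH] M b; apply: boundedS => P.
all: case/step_Named_inv=> [[M' st ->]|[Q e ->]].
- by case: (b _ st).
- apply: bounded_mren; apply: (@bounded_inner _ _ Mu); last by rewrite -e.
  by move=> *; apply: step_Mu.
- by apply: IH; apply: b.
- apply: bounded_mren; apply: (@bounded_inner _ _ Mu); last by rewrite -e.
  by move=> *; apply: step_Mu.
Qed.

Fixpoint neutral (M : term) : bool :=
  match M with
  | Var _ => true
  | App M _ => neutral M
  | _ => false
  end.

Lemma neutral_step M P : neutral M -> step M P -> neutral P.
Proof. by move=> nM st; elim: st nM => //=. Qed.

(** A neutral operator stays neutral, so no redex ever arises at the root and the steps of the two
    sides merely interleave. *)
Lemma bounded_App_neutral n m M N :
  neutral M -> bounded n M -> bounded m N -> bounded (n + m) (App M N).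
Proof.
have [k le] := ubnP (n + m); elim: k => // k IH in n m M N le *.
move=> nM bM bN; suff: forall P, step (App M N) P ->
    exists2 p, n + m = p.+1 & bounded p P.
  by case: (n + m) => [|p] H P /H [q] // [->].
move=> P /step_App_inv [[Q e _]|[Q e _]|[M' st ->]|[N' st ->]].
- by rewrite e in nM.
- by rewrite e in nM.
- case: n bM le => [|n] bM le; first by case: (bM _ st).
  exists (n + m) => //; apply: IH (neutral_step nM st) (bM _ st) bN; lia.
- case: m bN le => [|m] bN le; first by case: (bN _ st).
  exists (n + m); first lia; apply: IH nM bM (bN _ st); lia.
Qed.

(** * Trees with head expansions, and cut elimination *)

(* Typing derivations of cut rank r and height n, in which a head step may also
   be undone ([etree_expand]). They only carry types for the bookkeeping of
   lengths: M itself need not be typable. *)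
Inductive etree (r : nat) : nat -> seq ty -> seq ty -> term -> ty -> Prop :=
  | etree_Var n G D x A : onth G x = Some A -> etree r n G D (Var x) A
  | etree_Lam n G D M A B :
      etree r n (A :: G) D M B -> etree r n.+1 G D (Lam M) (Arrow A B)
  | etree_Mu n G D M A : etree r n G (A :: D) M Bot -> etree r n.+1 G D (Mu M) A
  | etree_Named n G D a M A :
      onth D a = Some A -> etree r n G D M A -> etree r n.+1 G D (Named a M) Bot
  | etree_App n G D M N A B :
      neutral M || (lh (Arrow A B) <= r) ->
      etree r n G D M (Arrow A B) -> etree r n G D N A ->
      etree r n.+1 G D (App M N) B
  | etree_expand n G D M N M' A C :
      head_step M N M' -> etree r n G D M' A -> etree r n G D N C ->
      etree r n.+1 G D M A.

Lemma etree_le r n m G D M A : etree r n G D M A -> n <= m -> etree r m G D M A.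
Proof.
move=> T; elim: T m => {n G D M A}.
- by move=> n G D x A e m _; apply: etree_Var.
- by move=> n G D M A B _ IH [|m] // le; apply/etree_Lam/IH.
- by move=> n G D M A _ IH [|m] // le; apply/etree_Mu/IH.
- by move=> n G D a M A e _ IH [|m] // le; apply: etree_Named e (IH _ le).
- move=> n G D M N A B c _ IHM _ IHN [|m] // le.
  exact: etree_App c (IHM _ le) (IHN _ le).
- move=> n G D M N M' A C hd _ IHM _ IHN [|m] // le.
  exact: etree_expand hd (IHM _ le) (IHN _ le).
Qed.

Definition ren_ok (f : nat -> nat) (G G' : seq ty) :=
  forall x A, onth G x = Some A -> onth G' (f x) = Some A.

Lemma ren_ok_up f G G' A : ren_ok f G G' -> ren_ok (up_ren f) (A :: G) (A :: G').
Proof. by move=> ok [|x] B //=; apply: ok. Qed.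

Lemma neutral_ren f g M : neutral (ren f g M) = neutral M.
Proof. by elim: M. Qed.

Lemma etree_ren r n f g G D G' D' M A :
  ren_ok f G G' -> ren_ok g D D' -> etree r n G D M A ->
  etree r n G' D' (ren f g M) A.
Proof.
move=> okf okg T; elim: T f g G' D' okf okg => {n G D M A} /=.
- by move=> n G D x A e f g G' D' okf okg; apply/etree_Var/okf.
- move=> n G D M A B _ IH f g G' D' okf okg.
  by apply/etree_Lam/IH => //; apply: ren_ok_up.
- move=> n G D M A _ IH f g G' D' okf okg.
  by apply/etree_Mu/IH => //; apply: ren_ok_up.
- move=> n G D a M A e _ IH f g G' D' okf okg.
  by apply: (etree_Named (okg _ _ e)); apply: IH.
- move=> n G D M N A B c _ IHM _ IHN f g G' D' okf okg.
  apply: (@etree_App _ _ _ _ _ _ A); rewrite ?neutral_ren //.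
    exact: IHM.
  exact: IHN.
- move=> n G D M N M' A C hd _ IHM _ IHN f g G' D' okf okg.
  apply: (@etree_expand _ _ _ _ _ (ren f g N) (ren f g M') _ C).
  + by rewrite !renE; apply: head_step_sub.
  + exact: IHM.
  + exact: IHN.
Qed.

(** A term put for a head variable may create a cut, hence the bound [r] on its type; a variable may
    have any type, since its applications stay neutral. *)
Definition lsub_ok r b s G G' D' := forall x A, onth G x = Some A ->
  (exists2 y, s x = Var y & onth G' y = Some A) \/
  (lh A <= r /\ etree r b G' D' (s x) A).

(** The bound is [r.+1], not [r], because [A] is here the type of the operator of the cut being
    removed, not of its argument. A name that takes an argument changes its type from [Arrow B C] to
    [C]. *)
Definition msub_ok r b (t : nat -> nat * seq term) D G' D' :=
  forall a A, onth D a = Some A ->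
  ((t a).2 = [::] /\ onth D' (t a).1 = Some A) \/
  (exists N B C, [/\ (t a).2 = [:: N], A = Arrow B C, lh A <= r.+1,
     onth D' (t a).1 = Some C & etree r b G' D' N B]).

Lemma lsub_ok_ren r b s G G' D' f g G'' D'' :
  ren_ok f G' G'' -> ren_ok g D' D'' -> lsub_ok r b s G G' D' ->
  lsub_ok r b (ren f g \o s) G G'' D''.
Proof.
move=> okf okg ok x A /ok [[y e ey]|[le T]].
  by left; exists (f y); rewrite /= ?e //; apply: okf.
by right; split=> //; apply: etree_ren T.
Qed.

Lemma lsub_ok_cons r b s A G G' D' :
  (exists2 y, s 0 = Var y & onth G' y = Some A) \/
    (lh A <= r /\ etree r b G' D' (s 0) A) ->
  lsub_ok r b (s \o succn) G G' D' -> lsub_ok r b s (A :: G) G' D'.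
Proof. by move=> H0 ok [|x] B /=; [case=> <- | apply: ok]. Qed.

Lemma msub_ok_ren r b t D G' D' f g G'' D'' :
  ren_ok f G' G'' -> ren_ok g D' D'' -> msub_ok r b t D G' D' ->
  msub_ok r b (tren f g t) D G'' D''.
Proof.
move=> okf okg ok a A /ok [[e ea]|[N [B [C [e eA le ea T]]]]].
  by left; rewrite /= e; split=> //; apply: okg.
right; exists (ren f g N), B, C; split=> //=; first by rewrite e.
  exact: okg.
exact: etree_ren T.
Qed.

(* The second conclusion also covers a [Named a M] whose name a is mapped to a
   name with an argument, which is why both are proved together. *)
Lemma etree_sub r n b G D M A s t G' D' :
  etree r n G D M A -> lsub_ok r b s G G' D' -> msub_ok r b t D G' D' ->
  [/\ etree r (2 * n + b) G' D' (sub s t M) A,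
      forall N B C, A = Arrow B C -> lh A <= r.+1 -> etree r b G' D' N B ->
        etree r (2 * n + b).+1 G' D' (App (sub s t M) N) C &
      neutral M -> neutral (sub s t M) || (lh A <= r)].
Proof.
move=> T; elim: T s t G' D' => {n G D M A}.
- move=> n G D x A e s t G' D' oks okt; case: (oks _ _ e) => [[y /= -> ey]|[le T]].
  + split=> //; first exact: etree_Var.
    move=> N B C eA le T; apply: (@etree_App _ _ _ _ _ _ B) => //.
      by apply: etree_Var; rewrite -eA.
    by apply: etree_le T _; lia.
  + split=> /=; last by rewrite le orbT.
      by apply: etree_le T _; lia.
    move=> N B C eA _ TN; rewrite {}eA in le T.
    apply: (@etree_App _ _ _ _ _ _ B); first by rewrite le orbT.
      by apply: etree_le T _; lia.
    by apply: etree_le TN _; lia.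
- move=> n G D M A B _ IH s t G' D' oks okt /=; split=> //.
    have -> : 2 * n.+1 + b = (2 * n + b).+2 by lia.
    apply: etree_Lam; apply: etree_le (leqnSn _).
    have [//||T _ _] := IH (lup s) (tren succn id t) (A :: G') D'.
    + apply: lsub_ok_cons; first by left; exists 0.
      exact: lsub_ok_ren oks.
    + exact: msub_ok_ren okt.
    + exact: T.
  move=> N B' C [<- <-] le TN.
  (* The cut becomes a head expansion of the body under a substitution extended by [N]; as
     [Arrow A B] has length at most [r.+1], the type of [N] has length at most [r]. *)
  apply: (@etree_expand _ _ _ _ _ _ _ _ A); first exact: head_beta.
    rewrite beta_subst_sub.
    have [//||T _ _] := IH (fun x => if x is y.+1 then s y else N) t G' D'.
    + apply: lsub_ok_cons => //; right; split=> //=; move: le => /=; lia.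
    + exact: okt.
    + by apply: etree_le T _; lia.
  by apply: etree_le TN _; lia.
- move=> n G D M A _ IH s t G' D' oks okt /=.
  have oks' E : lsub_ok r b (fun x => ren id succn (s x)) G G' (E :: D').
    exact: lsub_ok_ren oks.
  split=> //.
    have -> : 2 * n.+1 + b = (2 * n + b).+2 by lia.
    apply: etree_Mu; apply: etree_le (leqnSn _).
    have [||T _ _] := IH (fun x => ren id succn (s x)) (mup t) G' (A :: D').
    + exact: oks'.
    + move=> [|a] E /=; first by case=> ->; left.
      move=> e; have ok : msub_ok r b (tren id succn t) D G' (A :: D').
        exact: msub_ok_ren okt.
      exact: ok e.
    + exact: T.
  move=> N B C eA le TN; rewrite {}eA in IH le.
  (* Again a head expansion; in the contractum the bound name takes [N] and its type drops to
     [C]. *)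
  apply: (@etree_expand _ _ _ _ _ _ _ _ B); first exact: head_mu.
    rewrite struct_subst_sub.
    have -> : 2 * n.+1 + b = (2 * n + b).+2 by lia.
    apply: etree_Mu; apply: etree_le (leqnSn _).
    have [||T _ _] := IH (fun x => ren id succn (s x)) (mcons N t) G' (C :: D').
    + exact: oks'.
    + move=> [|a] E /=.
        case=> <-; right; exists (ren id succn N), B, C; split=> //=.
        exact: etree_ren TN.
      move=> e; have ok : msub_ok r b (tren id succn t) D G' (C :: D').
        exact: msub_ok_ren okt.
      exact: ok e.
    + exact: T.
  by apply: etree_le TN _; lia.
- move=> n G D a M A e _ IH s t G' D' oks okt /=; split=> //.
  have [T TA _] := IH _ _ _ _ oks okt.
  have -> : 2 * n.+1 + b = (2 * n + b).+2 by lia.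
  (* A name and its new argument may cost two levels, which is the source of the factor 2 in the
     height. *)
  case: (okt _ _ e) => [[-> ea]|[N [B [C [-> eA le ea TN]]]]] /=.
    apply: etree_Named ea _; exact: etree_le T (leqnSn _).
  by apply: etree_Named ea _; apply: TA eA le TN.
- move=> n G D M N A B c _ IHM _ IHN s t G' D' oks okt /=.
  have [TM _ nM] := IHM _ _ _ _ oks okt; have [TN _ _] := IHN _ _ _ _ oks okt.
  have c' : neutral (sub s t M) || (lh (Arrow A B) <= r).
    by case/orP: c => [/nM //|->]; rewrite orbT.
  have T : etree r (2 * n + b).+1 G' D' (App (sub s t M) (sub s t N)) B.
    exact: etree_App c' TM TN.
  (* The type [B] is shorter than [Arrow A B], so applying the result once more creates no cut of
     rank above [r]. *)
  have cB : neutral (sub s t M) || (lh B <= r).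
    by case/orP: c' => [->|/= ?] //; apply/orP; right; lia.
  split=> //.
    by apply: etree_le T _; lia.
  move=> P B' C eB le TP; rewrite eB in T cB.
  have -> : 2 * n.+1 + b = (2 * n + b).+2 by lia.
  apply: (@etree_App _ _ _ _ _ _ B') => //.
    exact: etree_le T (leqnSn _).
  by apply: etree_le TP _; lia.
- move=> n G D M N M' A C hd _ IHM _ IHN s t G' D' oks okt.
  have [TM TMA _] := IHM _ _ _ _ oks okt; have [TN _ _] := IHN _ _ _ _ oks okt.
  have hd' := head_step_sub s t hd.
  have -> : 2 * n.+1 + b = (2 * n + b).+2 by lia.
  split; last first.
  + by move=> nM; elim: hd nM => // {}M P {}M' {}N _ IH /= /IH.
  + move=> P B E eA le TP.
    (* The head step is also one below the further argument [P], so [P] can be passed to the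
       contractum. *)
    apply: (etree_expand (head_App P hd') (C := C)).
      exact: etree_le (TMA _ _ _ eA le TP) (leqnSn _).
    exact: etree_le TN (leqW (leqnSn _)).
  + apply: (etree_expand hd' (C := C)).
      exact: etree_le TM (leqnSn _).
    exact: etree_le TN (leqnSn _).
Qed.

(** This is the second conclusion of [etree_sub] at the identity substitution. *)
Lemma etree_cut r n b G D M N A B :
  lh (Arrow A B) <= r.+1 ->
  etree r n G D M (Arrow A B) -> etree r b G D N A ->
  etree r (2 * n + b).+1 G D (App M N) B.
Proof.
move=> le TM TN.
have [||_ T _] := etree_sub (s := Var) (t := noarg id) (G' := G) (D' := D)
  (b := b) TM.
- by move=> x C e; left; exists x.
- by move=> a C e; left.
- by rewrite sub_id // in T; apply: T TN.
Qed.

Lemma etree_cut_elim r n G D M A :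
  etree r.+1 n G D M A -> etree r (4 ^ n) G D M A.
Proof.
elim=> {n G D M A}.
- by move=> n G D x A e; apply: etree_Var.
- move=> n G D M A B _ T; apply: etree_le (etree_Lam T) _.
  by rewrite expnS; have := expn_gt0 4 n; lia.
- move=> n G D M A _ T; apply: etree_le (etree_Mu T) _.
  by rewrite expnS; have := expn_gt0 4 n; lia.
- move=> n G D a M A e _ T; apply: etree_le (etree_Named e T) _.
  by rewrite expnS; have := expn_gt0 4 n; lia.
- move=> n G D M N A B c _ TM _ TN.
  have pos := expn_gt0 4 n.
  case/orP: c => [nM|le].
    apply: (@etree_le _ (4 ^ n).+1); last by rewrite expnS; lia.
    by apply: etree_App TM TN; rewrite nM.
  (* Both premises now have height [4 ^ n], so the removed cut yields [3 * 4 ^ n + 1], at most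
     [4 ^ n.+1]. *)
  by apply: etree_le (etree_cut le TM TN) _; rewrite expnS; lia.
- move=> n G D M N M' A C hd _ TM _ TN; apply: etree_le (etree_expand hd TM TN) _.
  by rewrite expnS; have := expn_gt0 4 n; lia.
Qed.

(** The bound [f n = 2 ^ n - 1] solves [f n.+1 = 2 * f n + 1], the recurrence of a head expansion;
    no other node costs more. *)
Lemma etree_bounded n G D M A : etree 0 n G D M A -> bounded (2 ^ n).-1 M.
Proof.
elim=> {n G D M A}.
- by move=> n G D x A _; apply: (@bounded_le 0) => // P st; inversion st.
- move=> n G D M A B _ b; apply: bounded_le (bounded_Lam b) _.
  by rewrite expnS; lia.
- move=> n G D M A _ b; apply: bounded_le (bounded_Mu b) _.
  by rewrite expnS; have := expn_gt0 2 n; lia.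
- move=> n G D a M A _ _ b; apply: bounded_le (bounded_Named b) _.
  by rewrite expnS; have := expn_gt0 2 n; lia.
(* An arrow type has positive length, so at cut rank 0 every operator is neutral. *)
- move=> n G D M N A B c _ bM _ bN; rewrite orbF in c.
  by apply: bounded_le (bounded_App_neutral c bM bN) _; rewrite expnS; lia.
- move=> n G D M N M' A C hd _ bM _ bN.
  apply: bounded_le (bounded_head_step hd bM bN) _.
  by rewrite expnS; have := expn_gt0 2 n; lia.
Qed.

(** * From typing derivations to trees *)

Lemma complexity_gt0 M : 0 < complexity M.
Proof.
by elim: M => //= [M _|M _|a M _|M IHM N _]; rewrite ?addn1 // addn_gt0 IHM.
Qed.

(** A cut need not be a redex, as its operator may itself be an application; but then a redex sits
    further down the head, and the operator types only get longer on the way to it. A [Named] has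
    type [Bot] and cannot be an operator. *)
Lemma redex_ranks_head k G D M A B (d : typing G D M (Arrow A B)) :
  all (leq^~ k) (redex_ranks d) ->
  [|| neutral M, is_Lam M || is_Mu M | lh (Arrow A B) <= k].
Proof.
(* The induction needs a variable type; of its being an arrow, only [T <> Bot] is kept. *)
move: d; set T := Arrow A B => d; have nb : T <> Bot by [].
clearbody T; elim: d nb => {G D M A B T} //=.
move=> G D M N A B dM IHM dN _ _; rewrite !all_cat => /and3P [rk rkM _].
have := IHM (fun e => ltac:(discriminate e)) rkM.
case/or3P => [->|redex|/= le] //; last by apply/orP; right; lia.
move: rk; rewrite redex /= => /andP [le _]; apply/orP; right; lia.
Qed.

Lemma typing_etree k G D M A (d : typing G D M A) :
  all (leq^~ k) (redex_ranks d) -> etree k (complexity M) G D M A.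
Proof.
elim: d => {G D M A} /=.
- by move=> G D x A e _; apply: etree_Var.
- by move=> G D M A B d IH /IH; rewrite addn1; apply: etree_Lam.
- move=> G D M N A B dM IHM dN IHN; rewrite !all_cat => /and3P [rk rkM rkN].
  (* Complexities are positive, so one more than their maximum is at most their sum. *)
  apply: (@etree_le _ (maxn (complexity M) (complexity N)).+1); last first.
    by have := complexity_gt0 M; have := complexity_gt0 N; lia.
  apply: (@etree_App _ _ _ _ _ _ A).
  + case/or3P: (redex_ranks_head rkM) => [->|redex|->] //; last by rewrite orbT.
    by move: rk; rewrite redex /= => /andP [-> _]; rewrite orbT.
  + exact: etree_le (IHM rkM) (leq_maxl _ _).
  + exact: etree_le (IHN rkN) (leq_maxr _ _).
- move=> G D a M A e d IH; rewrite all_cat addn1 => /andP [_ /IH].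
  exact: etree_Named.
- by move=> G D M A d IH; rewrite all_cat addn1 => /andP [_ /IH]; apply: etree_Mu.
Qed.

(** * Iterated cut elimination and the tower bound *)

Lemma etree_cut_elim_all r n G D M A :
  etree r n G D M A -> etree 0 (iter r (expn 4) n) G D M A.
Proof.
by elim: r n => // r IH n /etree_cut_elim /IH; rewrite iterSr.
Qed.

Lemma tower_ltn k : {homo tower k : m n / m < n}.
Proof. by elim: k => // k IH m n /IH; rewrite /tower /= ltn_exp2l. Qed.

(** Since [4 ^ Y = 2 ^ (2 * Y)], each level doubles an exponent, for which the factor 2 is carried
    along; the resulting exponent [2 * Y + 1] is absorbed by raising the argument of the tower by
    [2 * m]. *)
Lemma iter_exp4_le_tower k m :
  0 < m -> 2 * iter k (expn 4) m <= tower k ((2 * k + 2) * m).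
Proof.
move=> m0; elim: k => [|k IH] /=; first by rewrite muln0.
set Y := iter k _ m in IH *.
have -> : 4 ^ Y = 2 ^ (2 * Y) by rewrite expnM.
rewrite -expnS leq_exp2l //; apply: leq_ltn_trans IH _.
by apply: tower_ltn; lia.
Qed.

Lemma bounded_length n M m (s : nat -> term) :
  bounded n M -> s 0 = M -> (forall i, i < m -> step (s i) (s i.+1)) -> m <= n.
Proof.
elim: n M m s => [|n IH] M [|m] s b s0 st //.
  by have := b (s 1); rewrite -s0 => /(_ (st 0 isT)).
apply: (IH (s 1) m (s \o succn)) => //=.
  by apply: b; rewrite -s0; apply: st.
by move=> i lt; apply: st.
Qed.

Theorem theorem4p22 (G D : seq ty) (M : term) (A : ty) (d : typing G D M A)
    (k : nat) (hk : rank d = k) (n : nat) (s : nat -> term) (hs0 : s 0 = M)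
    (hs : forall i : nat, i < n -> step (s i) (s i.+1)) :
  n < tower (k + 1) ((2 * k + 3) * complexity M).
Proof.
have pos := complexity_gt0 M.
have rk : all (leq^~ k) (redex_ranks d).
  by apply/allP => r r_in; rewrite -hk; apply: leq_bigmax_seq.
have b := etree_bounded (etree_cut_elim_all (typing_etree rk)).
have := bounded_length b hs0 hs; set X := iter _ _ _ => le.
apply: (@leq_ltn_trans (2 ^ X).-1) => //.
apply: (@leq_trans (2 ^ X)); first by rewrite prednK // expn_gt0.
(* Both sides are powers of 2, so it remains to bound [X] by the tower of height [k]. *)
rewrite addn1 leq_exp2l //; have H := iter_exp4_le_tower k pos.
have L : tower k ((2 * k + 2) * complexity M) < tower k ((2 * k + 3) * complexity M).
  by apply: tower_ltn; lia.
by rewrite -/X in H; apply: leq_trans (ltnW L); lia.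
Qed.
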